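(* Let $\epsilon>0$ and $\kappa>0$, and consider the convex program $$\min_{\Phi,P,q,\lambda\ge0}\ J(P,\lambda,q)=\lambda\theta-\frac{\lambda\epsilon}{2}\log\det\Sigma+\frac{\lambda\epsilon n_\xi}{2}\log\left(\frac{\lambda\epsilon}{2}\right)-\frac{\lambda\epsilon}{2}\log\det(\lambda\Omega-P)+\frac1N\sum_{i=1}^Nq_i$$ subject to $$\begin{bmatrix}\lambda\Omega-P&\lambda\hat\xi_i\\ \lambda\hat\xi_i^\top&\lambda\hat\xi_i^\top\hat\xi_i+q_i\end{bmatrix}\succeq0\ (i=1,\dots,N),\quad \begin{bmatrix}P&Q^\top\Phi^\top\\ \Phi Q&I\end{bmatrix}\succeq0,\quad \lambda\Omega-P\succeq\kappa I,$$ $$\Phi R=I,\quad \Phi=[\Phi_x\ \Phi_y],\quad \Phi_x,\Phi_y\ \text{block lower-triangular},$$ where $\Omega=I+\frac{\epsilon}{2}\Sigma^{-1}$. Assume the problem is strictly feasible, in the sense that $\theta>\theta_0$ with $$\theta_0=\frac{\epsilon}{2}\log\det\Sigma-\frac{\epsilon n_\xi}{2}\log\left(\frac{\epsilon}{2}\right)+\frac{\epsilon}{2}\log\det\Omega+\frac1N\sum_{i=1}^N\hat\xi_i^\top(I-\Omega^{-1})\hat\xi_i,$$ and that a feasible solution $(\Phi^{(0)},P^{(0)},\lambda^{(0)},q^{(0)})$ is known. Then the optimal Lagrange multiplier $\lambda^{\star}$ (the $\lambda$-component of an optimal solution) satisfies $$\lambda^{\star}\le\frac{\hat J(P^{(0)},\lambda^{(0)})}{\theta-\theta_0},$$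 where $$\hat J(P,\lambda)=\lambda\theta-\frac{\lambda\epsilon}{2}\log\det\Sigma+\frac{\lambda\epsilon n_\xi}{2}\log\left(\frac{\lambda\epsilon}{2}\right)-\frac{\lambda\epsilon}{2}\log\det(\lambda\Omega-P)+\frac1N\sum_{i=1}^N\left[\lambda^2\hat\xi_i^\top(\lambda\Omega-P)^{-1}\hat\xi_i-\lambda\hat\xi_i^\top\hat\xi_i\right].$$
   Context: Data: $\theta\ge 0$ is a radius, $\Sigma\in\mathbb{R}^{n_\xi\times n_\xi}$ with $\Sigma\succ0$ is the covariance of a reference Gaussian, $\hat\xi_1,\dots,\hat\xi_N\in\mathbb{R}^{n_\xi}$ are given samples, and $\kappa$ is a sufficiently small positive number. Variables: $P\in\mathbb{S}^{n_\xi}$ (symmetric), $q=(q_1,\dots,q_N)\in\mathbb{R}^N$, $\lambda\in\mathbb{R}$, $\Phi_x\in\mathbb{R}^{(T+1)n_x\times(T+1)n_x}$, $\Phi_y\in\mathbb{R}^{(T+1)n_x\times(T+1)n_y}$ (block lower-triangular with respect to the $(T+1)\times(T+1)$ block partition). Matrices $R,Q$: given $A_t\in\mathbb{R}^{n_x\times n_x}$, $B_t\in\mathbb{R}^{n_x\times n_w}$, $C_t\in\mathbb{R}^{n_y\times n_x}$, $D_t\in\mathbb{R}^{n_y\times n_w}$ of a (uniformly completely observable) linear time-varying system $x(t+1)=A_tx(t)+B_tw(t)$, $y(t)=C_tx(t)+D_tw(t)$, initial time $t_0$, horizon $T\ge n_x$, $n_\xi=n_x+Tn_w$; $Z$ is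 the $(T+1)n_x\times(T+1)n_x$ block-downshift matrix (blocks $I_{n_x}$ on the first block subdiagonal, zero elsewhere); $\bar A=\mathrm{diag}\{A_{t_0},\dots,A_{t_0+T-1},0_{n_x\times n_x}\}$, $\bar B=\mathrm{diag}\{I_{n_x},B_{t_0},\dots,B_{t_0+T-1}\}$, $\bar C=\mathrm{diag}\{0_{n_y\times n_x},C_{t_0},\dots,C_{t_0+T-1}\}$, $\bar D=\mathrm{diag}\{0_{n_y\times n_x},D_{t_0},\dots,D_{t_0+T-1}\}$; and $$R=\begin{bmatrix}I-Z\bar A\\ \bar CZ\end{bmatrix},\qquad Q=\begin{bmatrix}\bar B\\-\bar D\end{bmatrix}.$$ *)

(* Defs.v *)
From HB Require Import structures.
From mathcomp Require Import all_boot all_order all_algebra.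
From mathcomp Require Import reals exp.

Set Implicit Arguments.
Unset Strict Implicit.
Unset Printing Implicit Defensive.

Import Order.TTheory GRing.Theory Num.Theory.

Local Open Scope ring_scope.

(* Symmetry is part of both definiteness notions. *)

Definition psdmx (R : realType) (n : nat) (A : 'M[R]_n) : Prop :=
  A^T = A /\ forall x : 'cV[R]_n, 0 <= (x^T *m A *m x) 0 0.

Definition pdmx (R : realType) (n : nat) (A : 'M[R]_n) : Prop :=
  A^T = A /\ forall x : 'cV[R]_n, x != 0 -> 0 < (x^T *m A *m x) 0 0.

(* Loewner order: A is below B when B - A is positive semidefinite. *)
Definition loewner_le (R : realType) (n : nat) (A B : 'M[R]_n) : Prop :=
  psdmx (B - A).

(* The linear time-varying system
     x(t+1) = A_t x(t) + B_t w(t),   y(t) = C_t x(t) + D_t w(t). *)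
Record ltv_system (R : realType) (nx nw ny : nat) := LTVSystem {
  sysA : nat -> 'M[R]_(nx, nx);
  sysB : nat -> 'M[R]_(nx, nw);
  sysC : nat -> 'M[R]_(ny, nx);
  sysD : nat -> 'M[R]_(ny, nw)
}.

(* State transition matrix A_{t+k-1} ... A_{t+1} A_t from time t to t+k. *)
Fixpoint transition (R : realType) (nx : nat) (A : nat -> 'M[R]_(nx, nx))
    (t k : nat) : 'M[R]_(nx, nx) :=
  if k is k'.+1 then A (t + k')%N *m transition A t k' else 1%:M.

(* Observability Gramian on the window t, ..., t+s-1. *)
Definition obs_gramian (R : realType) (nx ny : nat)
    (A : nat -> 'M[R]_(nx, nx)) (C : nat -> 'M[R]_(ny, nx))
    (t s : nat) : 'M[R]_(nx, nx) :=
  \sum_(k < s) (C (t + k)%N *m transition A t k)^T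
               *m (C (t + k)%N *m transition A t k).

(* Uniform complete observability in Kalman's sense: over windows of some
   fixed length the Gramian has positive lower and upper bounds that are
   uniform in the initial time. *)
Definition uniformly_completely_observable (R : realType) (nx nw ny : nat)
    (S : ltv_system R nx nw ny) : Prop :=
  exists (s : nat) (alpha beta : R),
    [/\ 0 < alpha, 0 < beta
      & forall t : nat,
          loewner_le alpha%:M (obs_gramian (sysA S) (sysC S) t s) /\
          loewner_le (obs_gramian (sysA S) (sysC S) t s) beta%:M].

(* Stacked signals over the horizon have T+1 blocks, numbered from 0. *)

(* (T+1) n, kept as a sum so that \mxblock and submxblock apply directly. *)
Definition stackdim (T n : nat) : nat := (\sum_(i < T.+1) n)%N.

(* Block 0 of xi = (x(t0), w(t0), ..., w(t0+T-1)) is the initial state, the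
   later blocks are the disturbances. *)
Definition xi_blockdim (nx nw k : nat) : nat := if k is _.+1 then nw else nx.

Definition xidim (T nx nw : nat) : nat :=
  (\sum_(j < T.+1) xi_blockdim nx nw j)%N.

Lemma stackdimE (T n : nat) : stackdim T n = (T.+1 * n)%N.
Proof. by rewrite /stackdim sum_nat_const card_ord. Qed.

Lemma xidimE (T nx nw : nat) : xidim T nx nw = (nx + T * nw)%N.
Proof.
by rewrite /xidim big_ord_recl /= sum_nat_const card_ord.
Qed.

Definition Zdown (R : realType) (T nx : nat) : 'M[R]_(stackdim T nx) :=
  \mxblock_(i < T.+1, j < T.+1)
     (if i == j.+1 :> nat then (1%:M : 'M[R]_(nx, nx)) else 0).

Definition Abar (R : realType) (nx nw ny : nat) (S : ltv_system R nx nw ny)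
    (t0 T : nat) : 'M[R]_(stackdim T nx) :=
  \mxblock_(i < T.+1, j < T.+1)
     (if (i == j) && (j < T)%N then sysA S (t0 + j)%N else 0).

(* k-th diagonal blocks of Bbar, Cbar and Dbar; the block 0 of Bbar and Dbar
   has nx columns, the later ones have nw. *)

Definition Bblock (R : realType) (nx nw ny : nat) (S : ltv_system R nx nw ny)
    (t0 k : nat) : 'M[R]_(nx, xi_blockdim nx nw k) :=
  match k return 'M[R]_(nx, xi_blockdim nx nw k) with
  | 0 => 1%:M
  | k'.+1 => sysB S (t0 + k')%N
  end.

Definition Cblock (R : realType) (nx nw ny : nat) (S : ltv_system R nx nw ny)
    (t0 k : nat) : 'M[R]_(ny, nx) :=
  if k is k'.+1 then sysC S (t0 + k')%N else 0.

Definition Dblock (R : realType) (nx nw ny : nat) (S : ltv_system R nx nw ny)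
    (t0 k : nat) : 'M[R]_(ny, xi_blockdim nx nw k) :=
  match k return 'M[R]_(ny, xi_blockdim nx nw k) with
  | 0 => 0
  | k'.+1 => sysD S (t0 + k')%N
  end.

Definition Bbar (R : realType) (nx nw ny : nat) (S : ltv_system R nx nw ny)
    (t0 T : nat) : 'M[R]_(stackdim T nx, xidim T nx nw) :=
  \mxblock_(i < T.+1, j < T.+1) (if i == j then Bblock S t0 j else 0).

Definition Cbar (R : realType) (nx nw ny : nat) (S : ltv_system R nx nw ny)
    (t0 T : nat) : 'M[R]_(stackdim T ny, stackdim T nx) :=
  \mxblock_(i < T.+1, j < T.+1) (if i == j then Cblock S t0 j else 0).

Definition Dbar (R : realType) (nx nw ny : nat) (S : ltv_system R nx nw ny)
    (t0 T : nat) : 'M[R]_(stackdim T ny, xidim T nx nw) :=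
  \mxblock_(i < T.+1, j < T.+1) (if i == j then Dblock S t0 j else 0).

Definition Rmx (R : realType) (nx nw ny : nat) (S : ltv_system R nx nw ny)
    (t0 T : nat) : 'M[R]_(stackdim T nx + stackdim T ny, stackdim T nx) :=
  col_mx (1%:M - Zdown R T nx *m Abar S t0 T) (Cbar S t0 T *m Zdown R T nx).

Definition Qmx (R : realType) (nx nw ny : nat) (S : ltv_system R nx nw ny)
    (t0 T : nat) : 'M[R]_(stackdim T nx + stackdim T ny, xidim T nx nw) :=
  col_mx (Bbar S t0 T) (- Dbar S t0 T).

Definition block_lower_triangular (R : realType) (T m n : nat)
    (M : 'M[R]_(stackdim T m, stackdim T n)) : Prop :=
  forall i j : 'I_T.+1, (i < j)%N ->
    @submxblock R T.+1 T.+1 (fun=> m) (fun=> n) M i j = 0.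

Definition Omega (R : realType) (n : nat) (eps : R) (Sigma : 'M[R]_n) :
    'M[R]_n :=
  1%:M + (eps / 2) *: invmx Sigma.

Record decision (R : realType) (T nx nw ny N : nat) := Decision {
  dPhix : 'M[R]_(stackdim T nx, stackdim T nx);
  dPhiy : 'M[R]_(stackdim T nx, stackdim T ny);
  dP : 'M[R]_(xidim T nx nw);
  dq : 'rV[R]_N;
  dlam : R
}.

Definition dPhi (R : realType) (T nx nw ny N : nat)
    (v : decision R T nx nw ny N) :
    'M[R]_(stackdim T nx, stackdim T nx + stackdim T ny) :=
  row_mx (dPhix v) (dPhiy v).

(* Library convention: ln is 0 on nonpositive reals, so a term
   lam * ln (c * lam) is 0 at lam = 0, its limit value. *)
Definition J (R : realType) (n N : nat) (eps theta : R) (Sigma P : 'M[R]_n)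
    (lam : R) (q : 'rV[R]_N) : R :=
  lam * theta
  - lam * eps / 2 * ln (\det Sigma)
  + lam * eps * n%:R / 2 * ln (lam * eps / 2)
  - lam * eps / 2 * ln (\det (lam *: Omega eps Sigma - P))
  + N%:R^-1 * \sum_(i < N) q 0 i.

Definition Jhat (R : realType) (n N : nat) (eps theta : R) (Sigma : 'M[R]_n)
    (xihat : 'I_N -> 'cV[R]_n) (P : 'M[R]_n) (lam : R) : R :=
  lam * theta
  - lam * eps / 2 * ln (\det Sigma)
  + lam * eps * n%:R / 2 * ln (lam * eps / 2)
  - lam * eps / 2 * ln (\det (lam *: Omega eps Sigma - P))
  + N%:R^-1 * \sum_(i < N)
      (lam ^+ 2 * ((xihat i)^T *m invmx (lam *: Omega eps Sigma - P)
                     *m xihat i) 0 0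
       - lam * ((xihat i)^T *m xihat i) 0 0).

Definition theta0 (R : realType) (n N : nat) (eps : R) (Sigma : 'M[R]_n)
    (xihat : 'I_N -> 'cV[R]_n) : R :=
  eps / 2 * ln (\det Sigma)
  - eps * n%:R / 2 * ln (eps / 2)
  + eps / 2 * ln (\det (Omega eps Sigma))
  + N%:R^-1 * \sum_(i < N)
      ((xihat i)^T *m (1%:M - invmx (Omega eps Sigma)) *m xihat i) 0 0.

Record feasible (R : realType) (nx nw ny : nat) (S : ltv_system R nx nw ny)
    (t0 T N : nat) (eps kappa : R) (Sigma : 'M[R]_(xidim T nx nw))
    (xihat : 'I_N -> 'cV[R]_(xidim T nx nw))
    (v : decision R T nx nw ny N) : Prop := Feasible {
  feas_lam : 0 <= dlam v;
  feas_sym : (dP v)^T = dP v;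
  feas_lmi_sample : forall i : 'I_N,
    psdmx (block_mx
      (dlam v *: Omega eps Sigma - dP v) (dlam v *: xihat i)
      (dlam v *: (xihat i)^T)
      (dlam v *: ((xihat i)^T *m xihat i) + (dq v 0 i)%:M));
  feas_lmi_P :
    psdmx (block_mx (dP v) ((Qmx S t0 T)^T *m (dPhi v)^T)
                    (dPhi v *m Qmx S t0 T) 1%:M);
  feas_kappa : loewner_le kappa%:M (dlam v *: Omega eps Sigma - dP v);
  feas_achievable : dPhi v *m Rmx S t0 T = 1%:M;
  feas_Phix : block_lower_triangular (dPhix v);
  feas_Phiy : block_lower_triangular (dPhiy v)
}.

Definition optimal (R : realType) (nx nw ny : nat) (S : ltv_system R nx nw ny)
    (t0 T N : nat) (eps kappa theta : R) (Sigma : 'M[R]_(xidim T nx nw))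
    (xihat : 'I_N -> 'cV[R]_(xidim T nx nw))
    (v : decision R T nx nw ny N) : Prop :=
  feasible S t0 eps kappa Sigma xihat v /\
  forall u : decision R T nx nw ny N,
    feasible S t0 eps kappa Sigma xihat u ->
    J eps theta Sigma (dP v) (dlam v) (dq v)
      <= J eps theta Sigma (dP u) (dlam u) (dq u).

(* Main.v *)
Require Import Defs.
From HB Require Import structures.
From mathcomp Require Import all_boot all_order all_algebra.
From mathcomp Require Import reals exp.
From mathcomp Require Import ring lra.

Set Implicit Arguments.
Unset Strict Implicit.
Unset Printing Implicit Defensive.

Import Order.TTheory GRing.Theory Num.Theory.

Local Open Scope ring_scope.

(** Write M = lam Omega - P, which is positive definite for every feasible
    point by the constraint M >= kappa I. The Schur complement of M in the
    i-th sample constraint shows that this constraint means exactly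
    q_i >= lam^2 xi_i^T M^-1 xi_i - lam xi_i^T xi_i. Hence J >= Jhat on
    feasible points ([Jhat_le_J]), with equality once every q_i is lowered to
    its bound, which keeps the point feasible ([tighten_feasible],
    [J_tighten]). Comparing the optimal point with the lowered v0 gives
      Jhat(P*, lam* ) <= J* <= Jhat(P0, lam0).

    For the lower bound, P >= 0 gives M <= lam Omega in the Loewner order.
    The determinant is monotone on positive definite matrices
    ([det_pdmx_loewner]) and inversion is antitone ([invmx_loewner]), so
    Jhat(P, lam) >= Jhat(0, lam). For lam > 0 the ln lam terms of
    Jhat(0, lam) cancel and leave lam (theta - theta0) ([Jhat_at0]). Dividing
    by theta - theta0 > 0 ends the proof.

    Both matrix facts rest on the monotonicity of the Schur complement, which
    comes from its description as a partial minimum of the quadratic form; no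
    diagonalization is needed. *)

(** * Quadratic forms and definite matrices *)

(** The quadratic form x |-> x^T A x. *)
Definition quad (R : realType) (n : nat) (A : 'M[R]_n) (x : 'cV[R]_n) : R :=
  (x^T *m A *m x) 0 0.

Lemma quad0 (R : realType) (n : nat) (A : 'M[R]_n) : quad A 0 = 0.
Proof. by rewrite /quad mulmx0 mxE. Qed.

Lemma quadD (R : realType) (n : nat) (A B : 'M[R]_n) (x : 'cV[R]_n) :
  quad (A + B) x = quad A x + quad B x.
Proof. by rewrite /quad mulmxDr mulmxDl mxE. Qed.

Lemma quadN (R : realType) (n : nat) (A : 'M[R]_n) (x : 'cV[R]_n) :
  quad (- A) x = - quad A x.
Proof. by rewrite /quad mulmxN mulNmx mxE. Qed.

Lemma quadZ (R : realType) (n : nat) (a : R) (A : 'M[R]_n) (x : 'cV[R]_n) :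
  quad (a *: A) x = a * quad A x.
Proof. by rewrite /quad -scalemxAr -scalemxAl mxE. Qed.

Lemma quad_scalar_ge0 (R : realType) (n : nat) (c : R) (x : 'cV[R]_n) :
  0 <= c -> 0 <= quad c%:M x.
Proof.
move=> c0; rewrite -scalemx1 quadZ mulr_ge0 // /quad mulmx1 mxE.
by apply: sumr_ge0 => i _; rewrite mxE -expr2 sqr_ge0.
Qed.

Lemma quad_scalar_gt0 (R : realType) (n : nat) (c : R) (x : 'cV[R]_n) :
  0 < c -> x != 0 -> 0 < quad c%:M x.
Proof.
move=> c0 xn0; rewrite lt0r quad_scalar_ge0 ?ltW // andbT.
apply: contra xn0; rewrite -scalemx1 quadZ mulf_eq0 gt_eqF //=.
rewrite /quad mulmx1 mxE => /eqP sum0; apply/eqP/colP => i; rewrite [RHS]mxE.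
have ge0 (j : 'I_n) : true -> 0 <= x^T 0 j * x j 0.
  by move=> _; rewrite mxE -expr2 sqr_ge0.
have/(_ i isT) := psumr_eq0P ge0 sum0.
by rewrite mxE -expr2 => /eqP; rewrite sqrf_eq0 => /eqP.
Qed.

Lemma quad_mx11 (R : realType) (a : 'M[R]_1) (x : 'cV[R]_1) :
  quad a x = a 0 0 * x 0 0 ^+ 2.
Proof. by rewrite /quad !mxE !big_ord1 !mxE !big_ord1 !mxE; ring. Qed.

Lemma quad_mx11_1 (R : realType) (a : 'M[R]_1) : quad a 1%:M = a 0 0.
Proof. by rewrite quad_mx11 mxE expr1n mulr1. Qed.

Lemma psdmx11 (R : realType) (a : 'M[R]_1) : psdmx a <-> 0 <= a 0 0.
Proof.
split=> [[_ /(_ 1%:M)]|a0].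
  by rewrite -/(quad a _) quad_mx11_1.
split; first by apply/matrixP => i j; rewrite mxE !ord1.
by move=> x; rewrite -/(quad a x) quad_mx11 mulr_ge0 // sqr_ge0.
Qed.

Lemma pdmxW (R : realType) (n : nat) (A : 'M[R]_n) : pdmx A -> psdmx A.
Proof.
move=> [sA A0]; split=> // x; have [->|/A0/ltW//] := eqVneq x 0.
by rewrite mulmx0 mxE.
Qed.

Lemma pdmxD (R : realType) (n : nat) (A B : 'M[R]_n) :
  pdmx A -> psdmx B -> pdmx (A + B).
Proof.
move=> [sA A0] [sB B0]; split; first by rewrite linearD /= sA sB.
by move=> x xn0; rewrite -/(quad _ x) quadD ltr_wpDr //; [exact: B0|exact: A0].
Qed.

Lemma pdmx_loewner (R : realType) (n : nat) (A B : 'M[R]_n) :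
  pdmx A -> loewner_le A B -> pdmx B.
Proof. by move=> A0 AB; rewrite -(subrK A B) addrC; apply: pdmxD. Qed.

Lemma pdmx_scalar (R : realType) (n : nat) (c : R) :
  0 < c -> pdmx (c%:M : 'M[R]_n).
Proof.
by move=> c0; split=> [|x xn0]; [rewrite tr_scalar_mx | exact: quad_scalar_gt0].
Qed.

Lemma pdmx_ulblock (R : realType) (m n : nat) (A : 'M[R]_m) (b : 'M[R]_(m, n))
    (c : 'M[R]_(n, m)) (D : 'M[R]_n) :
  pdmx (block_mx A b c D) -> pdmx A.
Proof.
move=> [s0 p0]; split.
  by move: s0; rewrite tr_block_mx => /eq_block_mx[].
move=> x xn0; have /p0 : col_mx x (0 : 'cV[R]_n) != 0.
  by apply: contra xn0 => /eqP; rewrite -[0 in RHS]col_mx0 => /eq_col_mx[-> _].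
by rewrite tr_col_mx mul_row_block trmx0 !mul0mx !addr0 mul_row_col mulmx0 addr0.
Qed.

Lemma psdmx_ulblock (R : realType) (m n : nat) (A : 'M[R]_m) (b : 'M[R]_(m, n))
    (c : 'M[R]_(n, m)) (D : 'M[R]_n) :
  psdmx (block_mx A b c D) -> psdmx A.
Proof.
move=> [s0 p0]; split.
  by move: s0; rewrite tr_block_mx => /eq_block_mx[].
move=> x; have := p0 (col_mx x (0 : 'cV[R]_n)).
by rewrite tr_col_mx mul_row_block trmx0 !mul0mx !addr0 mul_row_col mulmx0 addr0.
Qed.

(** * Schur complements *)

(** The Schur complement of the upper left block A in [A, b; b^T, D]. *)
Definition schur (R : realType) (m n : nat) (A : 'M[R]_m) (b : 'M[R]_(m, n))
    (D : 'M[R]_n) : 'M[R]_n := D - b^T *m invmx A *m b.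

(** Completion of the square in the first block of variables. *)
Lemma quad_block_schur (R : realType) (m n : nat) (A : 'M[R]_m)
    (b : 'M[R]_(m, n)) (D : 'M[R]_n) (x : 'cV[R]_m) (y : 'cV[R]_n) :
  A^T = A -> A \in unitmx ->
  quad (block_mx A b b^T D) (col_mx x y)
    = quad A (x + invmx A *m b *m y) + quad (schur A b D) y.
Proof.
move=> sA uA; rewrite /quad tr_col_mx mul_row_block mul_row_col.
set u := invmx A *m b *m y.
have Au : A *m u = b *m y by rewrite /u -mulmxA mulKVmx.
have uTA : u^T *m A = y^T *m b^T.
  by rewrite -[A in LHS]sA -trmx_mul Au trmx_mul.
have yu : y^T *m (b^T *m invmx A *m b) *m y = y^T *m b^T *m u.
  by rewrite /u !mulmxA.
rewrite /schur mulmxBr mulmxBl yu [(x + u)^T]linearD /= !mulmxDl !mulmxDr uTA.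
rewrite -[x^T *m A *m u]mulmxA Au !mulmxA !mxE.
by ring.
Qed.

Lemma trmx_schur (R : realType) (m n : nat) (A : 'M[R]_m) (b : 'M[R]_(m, n))
    (D : 'M[R]_n) : A^T = A -> D^T = D -> (schur A b D)^T = schur A b D.
Proof.
move=> sA sD.
by rewrite /schur linearB /= !trmx_mul trmxK trmx_inv sA sD mulmxA.
Qed.

Lemma psdmx_block_schur (R : realType) (m n : nat) (A : 'M[R]_m)
    (b : 'M[R]_(m, n)) (D : 'M[R]_n) :
  psdmx A -> A \in unitmx ->
  psdmx (block_mx A b b^T D) <-> psdmx (schur A b D).
Proof.
move=> [sA A0] uA; split=> [[s0 p0]|[s0 p0]].
  have sD : D^T = D by move: s0; rewrite tr_block_mx => /eq_block_mx[].
  split=> [|y]; first exact: trmx_schur.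
  (* The first block of variables is chosen to make the completed square 0. *)
  have := p0 (col_mx (- (invmx A *m b *m y)) y).
  by rewrite -/(quad _ _) quad_block_schur // addNr quad0 add0r.
split.
  have sD : D^T = D.
    move: s0; rewrite /schur linearB /= !trmx_mul trmxK trmx_inv sA mulmxA.
    by move/addIr.
  by rewrite tr_block_mx trmxK sA sD.
move=> z; rewrite -(vsubmxK z) -/(quad _ _) quad_block_schur //.
by rewrite addr_ge0 //; [exact: A0|exact: p0].
Qed.

Lemma pdmx_schur (R : realType) (m n : nat) (A : 'M[R]_m)
    (b : 'M[R]_(m, n)) (D : 'M[R]_n) :
  A \in unitmx -> pdmx (block_mx A b b^T D) -> pdmx (schur A b D).
Proof.
move=> uA [s0 p0].
have [sA sD] : A^T = A /\ D^T = D.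
  by move: s0; rewrite tr_block_mx => /eq_block_mx[].
split=> [|y yn0]; first exact: trmx_schur.
have /p0 : col_mx (- (invmx A *m b *m y)) y != 0.
  by apply: contra yn0 => /eqP; rewrite -[0 in RHS]col_mx0 => /eq_col_mx[_ ->].
by rewrite -/(quad _ _) quad_block_schur // addNr quad0 add0r.
Qed.

(** The Schur complement is monotone, because its quadratic form at y is the
    minimum over x of the quadratic form of the whole matrix at (x, y). *)
Lemma schur_loewner (R : realType) (m n : nat) (A A' : 'M[R]_m)
    (b b' : 'M[R]_(m, n)) (D D' : 'M[R]_n) :
  psdmx A -> A \in unitmx -> psdmx A' -> A' \in unitmx ->
  loewner_le (block_mx A b b^T D) (block_mx A' b' b'^T D') ->
  D^T = D -> D'^T = D' ->
  loewner_le (schur A b D) (schur A' b' D').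
Proof.
move=> [sA A0] uA [sA' A0'] uA' [_ le] sD sD'.
split=> [|y]; first by rewrite linearB /= !trmx_schur.
(* x is the minimizer for the larger matrix: there the larger form equals its
   Schur form, and the smaller form is at least its own Schur form. *)
have := le (col_mx (- (invmx A' *m b' *m y)) y).
rewrite -!/(quad _ _) !(quadD, quadN) !quad_block_schur // addNr quad0 add0r.
have := A0 (- (invmx A' *m b' *m y) + invmx A *m b *m y).
by rewrite -!/(quad _ _) !quadD !quadN; lra.
Qed.

Lemma det_block_schur (R : realType) (m n : nat) (A : 'M[R]_m)
    (b : 'M[R]_(m, n)) (D : 'M[R]_n) :
  A \in unitmx ->
  \det (block_mx A b b^T D) = \det A * \det (schur A b D).
Proof.
move=> uA.
have -> : block_mx A b b^T D
    = block_mx 1%:M 0 (b^T *m invmx A) 1%:M *m block_mx A b 0 (schur A b D).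
  rewrite mulmx_block !mul1mx !mul0mx !addr0 mulmxKV //.
  by rewrite /schur addrC subrK.
by rewrite det_mulmx det_lblock !det1 mul1r mul1r det_ublock.
Qed.

(** * Monotonicity of the determinant and of the inverse *)

(** By induction on the size, splitting off the first row and column: both
    factors of det = a * det (schur a b D) are positive and monotone. *)
Lemma det_pdmx_loewner (R : realType) (n : nat) (A B : 'M[R]_n) :
  pdmx A -> loewner_le A B -> 0 < \det A <= \det B.
Proof.
elim: n A B => [|n IHn] A B; first by rewrite !det_mx00 ltr01 lexx.
rewrite -[n.+1]/(1 + n)%N in A B *.
move=> pA AB; have pB := pdmx_loewner pA AB.
have block_sym (M : 'M[R]_(1 + n)) : M^T = M ->
    M = block_mx (ulsubmx M) (ursubmx M) (ursubmx M)^T (drsubmx M)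
    /\ (drsubmx M)^T = drsubmx M.
  move=> sM; have := sM; rewrite -{1 2}(submxK M) tr_block_mx.
  case/eq_block_mx=> _ _ Mur Mdr.
  by rewrite Mur submxK.
have [eA sDA] := block_sym A pA.1; have [eB sDB] := block_sym B pB.1.
move: eA eB pA pB AB sDA sDB.
set a := ulsubmx A; set b := ursubmx A; set D := drsubmx A.
set a' := ulsubmx B; set b' := ursubmx B; set D' := drsubmx B.
move=> -> -> pA pB AB sD sD'.
have pa := pdmx_ulblock pA; have pa' := pdmx_ulblock pB.
have det1_gt0 (c : 'M[R]_1) : pdmx c -> 0 < \det c.
  move=> [_ /(_ 1%:M)]; rewrite -/(quad _ _) quad_mx11_1 det_mx11.
  by apply; apply/eqP => /matrixP/(_ 0 0); rewrite !mxE => /eqP; rewrite oner_eq0.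
have ua : a \in unitmx by rewrite unitmxE unitfE gt_eqF // det1_gt0.
have ua' : a' \in unitmx by rewrite unitmxE unitfE gt_eqF // det1_gt0.
rewrite !det_block_schur //.
have /andP[s0 ss'] : 0 < \det (schur a b D) <= \det (schur a' b' D').
  apply: IHn; first exact: pdmx_schur.
  by apply: schur_loewner => //; apply: pdmxW.
rewrite mulr_gt0 ?det1_gt0 //=.
apply: ler_pM => //; [exact/ltW/det1_gt0 | exact: ltW | rewrite !det_mx11].
(* The first basis vector compares the upper left entries. *)
have [_ /(_ (col_mx 1%:M 0))] := AB.
rewrite -/(quad _ _) quadD quadN /quad !tr_col_mx !mul_row_block trmx0 !mul0mx.
rewrite !addr0 !mul_row_col !mulmx0 !addr0 -!/(quad _ _).
by rewrite !quad_mx11_1 subr_ge0.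
Qed.

Lemma det_pdmx_gt0 (R : realType) (n : nat) (A : 'M[R]_n) : pdmx A -> 0 < \det A.
Proof.
move=> pA; have /(det_pdmx_loewner pA)/andP[] // : loewner_le A A.
by rewrite /loewner_le subrr; split=> [|x]; rewrite ?trmx0 // mulmx0 mul0mx mxE.
Qed.

Lemma pdmx_unit (R : realType) (n : nat) (A : 'M[R]_n) : pdmx A -> A \in unitmx.
Proof. by move=> pA; rewrite unitmxE unitfE gt_eqF // det_pdmx_gt0. Qed.

(** The Schur complement of A in [A, I; I, A^-1] is 0, and that of B in
    [B, I; I, A^-1] is A^-1 - B^-1, so this is an instance of
    [schur_loewner]. *)
Lemma invmx_loewner (R : realType) (n : nat) (A B : 'M[R]_n) :
  pdmx A -> loewner_le A B -> loewner_le (invmx B) (invmx A).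
Proof.
move=> pA AB; have pB := pdmx_loewner pA AB.
have := schur_loewner (pdmxW pA) (pdmx_unit pA) (pdmxW pB) (pdmx_unit pB)
  (b := 1%:M) (b' := 1%:M) (D := invmx A) (D' := invmx A).
rewrite /schur trmx1 !mul1mx !mulmx1 subrr /loewner_le subr0; apply.
- have [sBA p] := AB; rewrite opp_block_mx add_block_mx !subrr; split.
    by rewrite tr_block_mx !trmx0 sBA.
  move=> z; rewrite -(vsubmxK z) tr_col_mx mul_row_block !mulmx0 !addr0.
  by rewrite mul_row_col mul0mx addr0; apply: p.
- by rewrite trmx_inv pA.1.
- by rewrite trmx_inv pA.1.
Qed.

(** * The reduced cost *)

(** The smallest q allowed by the sample constraint at xi, when
    lam Omega - P is positive definite. *)
Definition qmin (R : realType) (n : nat) (eps : R) (Sigma P : 'M[R]_n)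
    (lam : R) (xi : 'cV[R]_n) : R :=
  lam ^+ 2 * (xi^T *m invmx (lam *: Omega eps Sigma - P) *m xi) 0 0
  - lam * (xi^T *m xi) 0 0.

Lemma sample_lmiE (R : realType) (n : nat) (eps : R) (Sigma P : 'M[R]_n)
    (lam q : R) (xi : 'cV[R]_n) :
  pdmx (lam *: Omega eps Sigma - P) ->
  psdmx (block_mx (lam *: Omega eps Sigma - P) (lam *: xi)
                  (lam *: xi^T) (lam *: (xi^T *m xi) + q%:M))
  <-> qmin eps Sigma P lam xi <= q.
Proof.
move=> pM; have -> : lam *: xi^T = (lam *: xi)^T by rewrite linearZ.
rewrite psdmx_block_schur; [|exact: pdmxW|exact: pdmx_unit].
rewrite psdmx11 /schur [(lam *: xi)^T]linearZ /= -!scalemxAl -scalemxAr.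
rewrite /qmin -[in X in _ <-> X]subr_ge0.
set u := _ *m invmx _ *m _; set w := xi^T *m xi.
have -> : (lam *: w + q%:M - lam *: (lam *: u)) 0 0
    = q - (lam ^+ 2 * u 0 0 - lam * w 0 0).
  by rewrite !mxE eqxx mulr1n; ring.
by [].
Qed.

Lemma feasible_pdmx (R : realType) (nx nw ny : nat) (S : ltv_system R nx nw ny)
    (t0 T N : nat) (eps kappa : R) (Sigma : 'M[R]_(xidim T nx nw))
    (xihat : 'I_N -> 'cV[R]_(xidim T nx nw)) (v : decision R T nx nw ny N) :
  0 < kappa -> feasible S t0 eps kappa Sigma xihat v ->
  pdmx (dlam v *: Omega eps Sigma - dP v).
Proof. by move=> k0 /feas_kappa; apply/pdmx_loewner/pdmx_scalar. Qed.

Lemma Jhat_le_J (R : realType) (nx nw ny : nat) (S : ltv_system R nx nw ny)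
    (t0 T N : nat) (eps kappa theta : R) (Sigma : 'M[R]_(xidim T nx nw))
    (xihat : 'I_N -> 'cV[R]_(xidim T nx nw)) (v : decision R T nx nw ny N) :
  0 < kappa -> feasible S t0 eps kappa Sigma xihat v ->
  Jhat eps theta Sigma xihat (dP v) (dlam v)
    <= J eps theta Sigma (dP v) (dlam v) (dq v).
Proof.
move=> k0 fv; rewrite lerD2l ler_wpM2l ?invr_ge0 ?ler0n //.
apply: ler_sum => i _; apply/(sample_lmiE _ _ (feasible_pdmx k0 fv)).
exact: (feas_lmi_sample fv).
Qed.

(** The point v with each q_i replaced by the value [qmin]. *)
Definition tighten (R : realType) (T nx nw ny N : nat) (eps : R)
    (Sigma : 'M[R]_(xidim T nx nw)) (xihat : 'I_N -> 'cV[R]_(xidim T nx nw))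
    (v : decision R T nx nw ny N) : decision R T nx nw ny N :=
  Decision (dPhix v) (dPhiy v) (dP v)
    (\row_i qmin eps Sigma (dP v) (dlam v) (xihat i)) (dlam v).

Lemma tighten_feasible (R : realType) (nx nw ny : nat)
    (S : ltv_system R nx nw ny) (t0 T N : nat) (eps kappa : R)
    (Sigma : 'M[R]_(xidim T nx nw)) (xihat : 'I_N -> 'cV[R]_(xidim T nx nw))
    (v : decision R T nx nw ny N) :
  0 < kappa -> feasible S t0 eps kappa Sigma xihat v ->
  feasible S t0 eps kappa Sigma xihat (tighten eps Sigma xihat v).
Proof.
move=> k0 fv; have pM := feasible_pdmx k0 fv; case: fv => *; split=> //= i.
by apply/sample_lmiE => //; rewrite mxE.
Qed.

Lemma J_tighten (R : realType) (T nx nw ny N : nat) (eps theta : R)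
    (Sigma : 'M[R]_(xidim T nx nw)) (xihat : 'I_N -> 'cV[R]_(xidim T nx nw))
    (v : decision R T nx nw ny N) :
  let u := tighten eps Sigma xihat v in
  J eps theta Sigma (dP u) (dlam u) (dq u)
    = Jhat eps theta Sigma xihat (dP v) (dlam v).
Proof. by congr (_ + _ * _); apply: eq_bigr => i _; rewrite mxE. Qed.

Lemma Jhat_at0 (R : realType) (n N : nat) (eps theta lam : R)
    (Sigma : 'M[R]_n) (xihat : 'I_N -> 'cV[R]_n) :
  0 < eps -> 0 < lam -> pdmx (Omega eps Sigma) ->
  Jhat eps theta Sigma xihat 0 lam = lam * (theta - theta0 eps Sigma xihat).
Proof.
move=> e0 l0 pO; have dO := det_pdmx_gt0 pO.
rewrite /Jhat /theta0 subr0 detZ.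
rewrite [ln (lam ^+ n * _)]lnM ?posrE ?exprn_gt0 // lnXn //.
rewrite -[lam * eps / 2]mulrA [ln (lam * _)]lnM ?posrE ?divr_gt0 //.
under eq_bigr => i _.
  rewrite invmxZ; last by rewrite unitmxZ ?pdmx_unit ?unitfE ?gt_eqF.
  rewrite -scalemxAr -scalemxAl mxE mulrA expr2 mulfK ?gt_eqF //.
  over.
under [in RHS]eq_bigr => i _ do
  rewrite -/(quad _ _) quadD quadN /quad mulmx1.
under eq_bigr => i _ do rewrite -mulrBr.
rewrite -mulr_sumr !sumrB.
(* The average over samples is handled as a free coefficient, so that N = 0 is
   covered. *)
by rewrite -[ln lam *+ n]mulr_natr; set c := N%:R^-1; field.
Qed.

Lemma Jhat_antitone (R : realType) (n N : nat) (eps theta lam : R)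
    (Sigma P : 'M[R]_n) (xihat : 'I_N -> 'cV[R]_n) :
  0 <= eps -> 0 <= lam -> psdmx P -> pdmx (lam *: Omega eps Sigma - P) ->
  Jhat eps theta Sigma xihat 0 lam <= Jhat eps theta Sigma xihat P lam.
Proof.
move=> e0 l0 pP pM; rewrite /Jhat subr0.
set M := lam *: _ - P in pM *; set L := lam *: _.
have ML : loewner_le M L by rewrite /loewner_le /M opprB addrC subrK.
have /andP[dM dML] := det_pdmx_loewner pM ML.
apply: lerD.
  rewrite lerD2l lerN2 ler_wpM2l ?divr_ge0 ?mulr_ge0 //.
  by rewrite ler_ln ?posrE // (lt_le_trans dM).
rewrite ler_wpM2l ?invr_ge0 ?ler0n //; apply: ler_sum => i _.
rewrite lerD2r ler_wpM2l ?sqr_ge0 //.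
have [_ /(_ (xihat i))] := invmx_loewner pM ML.
by rewrite -/(quad _ _) quadD quadN subr_ge0.
Qed.

Lemma Jhat_lower_bound (R : realType) (n N : nat) (eps theta lam : R)
    (Sigma P : 'M[R]_n) (xihat : 'I_N -> 'cV[R]_n) :
  0 < eps -> 0 <= lam -> psdmx P -> pdmx (lam *: Omega eps Sigma - P) ->
  lam * (theta - theta0 eps Sigma xihat) <= Jhat eps theta Sigma xihat P lam.
Proof.
move=> e0; rewrite le0r => /predU1P[-> _ _|l0 pP pM].
  (* At lam = 0 every term of Jhat carries a factor lam. *)
  rewrite /Jhat mul0r big1 => [|i _]; first by rewrite !mul0r mulr0 !(addr0, subr0).
  by rewrite expr0n /= !mul0r subr0.
have pL : pdmx (lam *: Omega eps Sigma).
  by rewrite -(subrK P (_ *: _)); apply: pdmxD.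
have pO : pdmx (Omega eps Sigma).
  split=> [|x xn0].
    move: pL.1; rewrite linearZ /=; apply: scalerI; exact: lt0r_neq0.
  by have := pL.2 x xn0; rewrite -!/(quad _ _) quadZ pmulr_rgt0.
by rewrite -Jhat_at0 //; apply: Jhat_antitone => //; apply: ltW.
Qed.

Theorem theorem5 (R : realType) (nx nw ny : nat) (S : ltv_system R nx nw ny)
    (t0 T N : nat) (eps kappa theta : R)
    (Sigma : 'M[R]_(xidim T nx nw))
    (xihat : 'I_N -> 'cV[R]_(xidim T nx nw))
    (hobs : uniformly_completely_observable S)
    (hT : (nx <= T)%N) (hN : (0 < N)%N)
    (heps : 0 < eps) (hkappa : 0 < kappa) (htheta : 0 <= theta)
    (hSigma : pdmx Sigma)
    (hstrict : theta0 eps Sigma xihat < theta)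
    (v0 : decision R T nx nw ny N)
    (hv0 : feasible S t0 eps kappa Sigma xihat v0)
    (vstar : decision R T nx nw ny N)
    (hvstar : optimal S t0 eps kappa theta Sigma xihat vstar) :
  dlam vstar <= Jhat eps theta Sigma xihat (dP v0) (dlam v0)
                / (theta - theta0 eps Sigma xihat).
Proof.
rewrite ler_pdivlMr ?subr_gt0 //; case: hvstar => fstar opt.
apply: le_trans (Jhat_lower_bound _ _ heps (feas_lam fstar)
  (psdmx_ulblock (feas_lmi_P fstar)) (feasible_pdmx hkappa fstar)) _.
apply: le_trans (Jhat_le_J theta hkappa fstar) _.
rewrite -J_tighten; exact: opt (tighten_feasible hkappa hv0).
Qed.
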